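(* Let $d\ge2$, $m\ge0$, $n\ge1$ be integers, and let $g(c)$ be an irreducible factor over $\mathbb{Q}$ (taken monic) of $G_d(m,n)$, with discriminant $D$. Let $c_0$ be a root of $g(c)$, and let $K=\mathbb{Q}(c_0)$ be the extension of $\mathbb{Q}$ defined by $g$, with ring of integers $\mathcal{O}_K$. Let $p$ be a prime, and assume that $p^k\mid D$ and that $p\nmid i(c_0)=[\mathcal{O}_K:\mathbb{Z}[c_0]]$. Then $$k\ge\sum_i(e_i-1)f_i,$$ where the sum is over the primes $q_i$ of $\mathcal{O}_K$ above $p$, the $e_i$ are their ramification indices, and the $f_i=\deg(q_i)$ are their residue degrees.
   Context: Let $f=f_{d,c}(z)=z^d+c$, with $f^k$ the $k$-th iterate ($f^0(z)=z$), and let $\mu$ be the Möbius function. The dynatomic polynomial is $\Phi^{\ast}_{f,n}(z)=\prod_{k\mid n}(f^k(z)-z)^{\mu(n/k)}$; the generalized dynatomic polynomial is $\Phi^{\ast}_{f,0,n}=\Phi^{\ast}_{f,n}$ and, for $m\ge1$, $\Phi^{\ast}_{f,m,n}(z)=\Phi^{\ast}_{f,n}(f^m(z))/\Phi^{\ast}_{f,n}(f^{m-1}(z))$. Then $G_d(m,n)$, a monic polynomial in $c$ with integer coefficients, is defined by $G_d(m,n)=\Phi^{\ast}_{f,m,n}(0)/\Phi^{\ast}_{f,0,n}(0)^{d-1}$ if $m\ne0$ and $n\mid(m-1)$, and $G_d(m,n)=\Phi^{\ast}_{f,m,n}(0)$ otherwise.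
   Formalization: The hypothesis ''p^k | D'' is read as p^k exactly dividing D (p^(k+1) does not divide D); with mere divisibility the claim fails, e.g. d=2, m=0, n=3, g=c^3+2c^2+c+1, D=-23, p=23, k=0, where the sum is 1. *)

(* Defs.v *)
From HB Require Import structures.
From mathcomp Require Import all_boot all_order all_algebra all_field.
From mathcomp Require Import boolp classical_sets.

Set Implicit Arguments.
Unset Strict Implicit.
Unset Printing Implicit Defensive.

Import Order.TTheory GRing.Theory Num.Theory.
Local Open Scope ring_scope.
Local Open Scope classical_set_scope.

Definition mobius (n : nat) : int :=
  if all (fun p => logn p n == 1)%N (primes n)
  then (-1) ^+ size (primes n) else 0.

(* The dynatomic polynomials are given by their defining quotients, as
   expressions in elements c and z of a field. In a field 1/0 = 0, so such an
   expression is the value of the polynomial only where no denominator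
   vanishes. This holds in the one place where they are used, z = 0 and
   c transcendental over Q: for k >= 1 and every j, the element
   f^(k+j)(0) - f^j(0) is a monic polynomial in c of positive degree. *)
Section Dynatomic.
Variables (F : fieldType) (d : nat) (c : F).

Definition unicritical (z : F) : F := z ^+ d + c.

Definition dynatomic (n : nat) (z : F) : F :=
  \prod_(k <- divisors n) (iter k unicritical z - z) ^ mobius (n %/ k)%N.

Definition gen_dynatomic (m n : nat) (z : F) : F :=
  if m is m'.+1
  then dynatomic n (iter m'.+1 unicritical z)
       / dynatomic n (iter m' unicritical z)
  else dynatomic n z.

End Dynatomic.

(* G_d(m,n), as an element of the field Q(c) of fractions of Q[c]. *)
Definition Gdmn (d m n : nat) : {fraction {poly rat}} :=
  let c : {fraction {poly rat}} := tofrac 'X in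
  if (m != 0)%N && (n %| m.-1)%N
  then gen_dynatomic d c m n 0 / gen_dynatomic d c 0 n 0 ^+ d.-1
  else gen_dynatomic d c m n 0.

Definition polynomial_factor (g : {poly rat}) (G : {fraction {poly rat}}) :=
  exists h : {poly rat}, G = tofrac (g * h).

Definition discriminant (F : fieldType) (g : {poly F}) : F :=
  (-1) ^+ 'C((size g).-1, 2) * resultant g g^`() / lead_coef g.

(* The cosets of the additive subgroup A of V are exactly i in number. *)
Definition has_index (V : zmodType) (A : set V) (i : nat) :=
  exists r : 'I_i -> V, forall x, exists! j, A (x - r j).

Section Ideals.
Variable R : comNzRingType.
Implicit Types (I J P : set R) (p : nat).

(* Unlike [idealr_closed], this allows I to be the whole ring. *)
Definition ideal I :=
  I 0 /\ forall a u v, I u -> I v -> I (a * u + v).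

Definition prime_ideal P :=
  [/\ ideal P, ~ P 1 & prime_idealr_closed (mem P)].

Definition ideal_mul I J : set R :=
  [set x | exists n (u v : 'I_n -> R),
     [/\ forall j, I (u j), forall j, J (v j) & x = \sum_j u j * v j]].

Definition ideal_exp I (n : nat) : set R := iter n (ideal_mul I) setT.

Definition principal (a : R) : set R := [set x | exists y, x = a * y].

Definition ideal_dvd I J := exists L, ideal L /\ J = ideal_mul I L.

Definition lies_above p P :=
  forall a : int, P a%:~R <-> (p%:Z %| a)%Z.

Definition has_ramification_index p P (e : nat) :=
  ideal_dvd (ideal_exp P e) (principal p%:R) /\
  ~ ideal_dvd (ideal_exp P e.+1) (principal p%:R).

(* R/P has an F_p-basis with f elements, i.e. [R/P : F_p] = f; b lists lifts
   of the basis vectors, and the coefficients are integers read modulo p. *)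
Definition has_residue_degree p P (f : nat) :=
  exists b : 'I_f -> R,
    (forall x, exists a : 'I_f -> int, P (x - \sum_j b j *~ a j)) /\
    (forall a : 'I_f -> int,
       P (\sum_j b j *~ a j) -> forall j, (p%:Z %| a j)%Z).

End Ideals.

Section RingOfIntegers.
Variable K : fieldExtType rat.

Definition algebraic_integer : {pred K} :=
  fun x => `[< integralOver (intr : int -> K) x >].

Fact algebraic_integer_subring : subring_closed algebraic_integer.
Proof.
split=> [|x y /asboolP hx /asboolP hy|x y /asboolP hx /asboolP hy];
  apply/asboolP.
- exact: integral1.
- exact: integral_sub.
- exact: integral_mul.
Qed.

HB.instance Definition _ :=
  GRing.isSubringClosed.Build K algebraic_integer algebraic_integer_subring.

Record ringOfIntegers := RingOfIntegers {
  int_val : K;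
  _ : int_val \in algebraic_integer }.

HB.instance Definition _ := [isSub for int_val].
HB.instance Definition _ := [Choice of ringOfIntegers by <:].
HB.instance Definition _ :=
  [SubChoice_isSubComNzRing of ringOfIntegers by <:].

(* Z[x], as a subset of the ring of integers (for x integral, all of Z[x]). *)
Definition monogenic_order (x : K) : set ringOfIntegers :=
  [set y | exists h : {poly int}, int_val y = (map_poly intr h).[x]].

End RingOfIntegers.

(* Main.v *)
Require Import Defs.
From HB Require Import structures.
From mathcomp Require Import all_boot all_order all_algebra all_field.
From mathcomp Require Import boolp classical_sets.
From mathcomp Require Import zify ring.

(** Why the inequality holds.  Let gbar be the reduction of g modulo p and O
    the ring of integers of K.

    Since the index of Z[c0] is prime to p, O = Z[c0] + pO.  Hence a prime P of
    O above p is determined by the polynomials over F_p whose integer lifts h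
    satisfy h(c0) in P, and these are the multiples of one irreducible
    polynomial G_P ([prime_residue_poly]).  Distinct primes have coprime
    polynomials ([residue_poly_coprime]), a residue degree f_P is at most
    deg G_P ([residue_degree_le]), and P ^ e dividing (p) forces G_P ^ e to
    divide gbar ([ramification_dvd]).

    Each G_P ^ (e_P - 1) then divides gbar and its derivative, and by
    coprimality so does the product of these powers, whose degree is at least
    the sum of the (e_P - 1) f_P.  A common divisor of degree s of gbar and
    gbar' yields s independent vectors in the kernel modulo p of the Sylvester
    matrix of g and g'.  By the Smith normal form a determinant with such a
    kernel is divisible by p ^ s ([dvdn_det_kernel_mod]), and so p ^ s divides
    the resultant of g and g', which is the discriminant up to sign.

    The discriminant of g controls primes above p only when c0 is integral:
    for c0 = sqrt 3 / 3, Z[c0] contains O = Z[sqrt 3], the numerator of the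
    discriminant 4 / 3 is prime to 3, and yet 3 ramifies.  Integrality comes
    from the dynamics.  The differences f^(k+j)(0) - f^j(0), k > 0, are monic
    integer polynomials in c, so that G_d(m,n) is a quotient of monic integer
    polynomials ([monic_ratio_Gdmn]).  Hence g divides a monic integer
    polynomial, and its coefficients are integers by Gauss's lemma. *)

Set Implicit Arguments.
Unset Strict Implicit.
Unset Printing Implicit Defensive.
Import Order.TTheory GRing.Theory Num.Theory.
Local Open Scope ring_scope.

Local Notation poly_mod p := (map_poly (intr : int -> 'F_p)).

(** * Determinants and resultants modulo p *)

Lemma mxrank_leq_support (F : fieldType) (m N : nat) (A : {set 'I_N})
    (B : 'M[F]_(m, N)) :
  (forall i j, j \notin A -> B i j = 0) -> (\rank B <= #|A|)%N.
Proof.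
move=> B0.
pose E : 'M[F]_(#|A|, N) := \matrix_(a, j) (enum_val a == j)%:R.
have -> : B = (\matrix_(i, a) B i (enum_val a)) *m E.
  apply/matrixP=> i j; rewrite !mxE.
  have [jA|jA] := boolP (j \in A); last first.
    rewrite B0 // big1 // => a _; rewrite !mxE.
    case: eqP => [ja|_]; last by rewrite mulr0.
    by rewrite -ja enum_valP in jA.
  rewrite (bigD1 (enum_rank_in jA j)) //= !mxE enum_rankK_in // eqxx mulr1.
  rewrite big1 ?addr0 // => a /eqP ne; rewrite !mxE.
  case: eqP => [aj|_]; last by rewrite mulr0.
  by case: ne; apply: enum_val_inj; rewrite enum_rankK_in.
exact: leq_trans (mxrankM_maxr _ _) (rank_leq_row _).
Qed.

(** Diagonalize M over the integers by unimodular matrices.  A diagonal matrix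
    kills modulo p only the vectors supported on the entries divisible by p,
    so that there are at least s such entries, and the determinant is up to a
    unit the product of all entries. *)
Lemma dvdn_det_kernel_mod (p : nat) (p_pr : prime p) (s N : nat)
    (M : 'M[int]_N) (B : 'M['F_p]_(s, N)) :
  row_free B -> B *m map_mx intr M = 0 -> (p ^ s %| `|\det M|)%N.
Proof.
move=> freeB BM0.
have [L Lu [T Tu [d _ defM]]] := int_Smith_normal_form M.
set D := (X in L *m X *m T) in defM.
have detD : \det D = \prod_(i < N) d`_i.
  have -> : D = diag_mx (\row_(i < N) d`_i).
    by apply/matrixP=> i j; rewrite !mxE.
  by rewrite det_diag; apply: eq_bigr => i _; rewrite mxE.
pose A : {set 'I_N} := [set i : 'I_N | (p%:Z %| d`_i)%Z].
have unit_red (X : 'M[int]_N) :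
    X \in unitmx -> map_mx (intr : int -> 'F_p) X \in unitmx.
  by rewrite !unitmxE det_map_mx; apply: rmorph_unit.
have leA : (s <= #|A|)%N.
  pose B' := B *m map_mx intr L.
  have <- : \rank B' = s.
    by rewrite mxrankMfree ?row_free_unit ?unit_red //; apply/eqP.
  apply: mxrank_leq_support => i j; rewrite inE => jA.
  have : B' *m map_mx intr D = 0.
    have Tfree : row_free (map_mx (intr : int -> 'F_p) T).
      by rewrite row_free_unit unit_red.
    apply: (row_free_inj Tfree).
    by rewrite mul0mx -mulmxA -map_mxM -[LHS]mulmxA -map_mxM mulmxA -defM.
  move: B' => B' /matrixP/(_ i j); rewrite !mxE (bigD1 j) //= !mxE eqxx mulr1n.
  rewrite big1 ?addr0 => [|l lj]; last first.
    by move/negPf: lj; rewrite !mxE -val_eqE /= => ->; rewrite mulr0n mulr0.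
  move/eqP; rewrite mulf_eq0 -(dvdz_pcharf (pchar_Fp p_pr)) (negPf jA) orbF.
  by move/eqP.
apply: (@dvdn_trans (p ^ #|A|)); first exact: dvdn_exp2l.
rewrite defM !det_mulmx detD !abszM.
apply/dvdn_mulr/dvdn_mull.
rewrite (bigID (mem A)) /= abszM; apply: dvdn_mulr.
rewrite -sum1_card expn_sum.
elim/big_rec2: _ => //= i y x iA.
rewrite expn1 abszM; move: iA; rewrite inE => iA; exact: dvdn_mul.
Qed.

(** If f = A w and h = B w modulo p, then (v B) f = (v A) h for every v of
    degree less than that of w: this is a family of vectors (v B, - v A) in the
    kernel of the Sylvester matrix modulo p.  The degrees fit also when p
    divides the leading coefficient of h, as happens for h = f' when p divides
    the degree of f. *)
Lemma dvdn_resultant_common_divisor (p : nat) (p_pr : prime p)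
    (f h : {poly int}) (w : {poly 'F_p}) :
  map_poly intr f != 0 :> {poly 'F_p} ->
  w %| map_poly intr f -> w %| map_poly intr h ->
  (p ^ (size w).-1 %| `|resultant f h|)%N.
Proof.
set f' := map_poly intr f => f'_neq0; set h' := map_poly intr h.
case/dvdpP=> A defA /dvdpP[B defB].
have [A0 w0] : A != 0 /\ w != 0.
  by apply/andP; rewrite -negb_or -mulf_eq0 -defA.
pose dh := (size h).-1; pose df := (size f).-1; pose t := (size w).-1.
pose band n m (u : {poly 'F_p}) : 'M_(n, m) :=
  lin1_mx (@poly_rV _ m \o u \o* @rVpoly _ n).
have bandE n m u (v : 'rV_n) : v *m band n m u = poly_rV (rVpoly v * u).
  by rewrite mul_rV_lin1.
have redS : map_mx intr (Sylvester_mx f h)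
    = col_mx (band dh (dh + df)%N f') (band df (dh + df)%N h').
  rewrite map_col_mx; congr col_mx; apply/matrixP=> i j;
    by rewrite !mxE /= !rVpoly_delta !coefXnM coef_map; case: ifP.
have size_cofactor n (v : 'rV_t) (l : {poly int}) (C : {poly 'F_p}) :
    map_poly intr l = C * w -> n = (size l).-1 ->
    (size (rVpoly v * C)%R <= n)%N.
  move=> lE ->; have [->|C0] := eqVneq C 0; first by rewrite mulr0 size_poly0.
  have [->|v0] := eqVneq (rVpoly v) 0; first by rewrite mul0r size_poly0.
  rewrite size_mul //.
  have : (size (C * w)%R <= size l)%N by rewrite -lE size_poly.
  rewrite size_mul //.
  have : (size (rVpoly v) <= t)%N by apply: size_poly.
  move: C0 w0 v0; rewrite -!size_poly_gt0 /t.
  (* Stated for natural numbers because the sizes occurring here are not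
     syntactically those of one and the same ring structure. *)
  have arith (a b y z : nat) : (0 < a -> 0 < b -> 0 < y -> y <= b.-1 ->
    (a + b).-1 <= z -> (y + a).-1 <= z.-1)%N by lia.
  exact: arith.
(* The map v |-> (v B, - v A), v of degree less than that of w. *)
pose ker := row_mx (band t dh B) (band t df (- A)).
apply: (@dvdn_det_kernel_mod _ p_pr t _ _ ker).
  apply: inj_row_free => v; rewrite mul_mx_row -row_mx0 !bandE.
  case/eq_row_mx=> _ /(congr1 rVpoly).
  rewrite mulrN raddfN raddfN /= poly_rV_K ?(size_cofactor _ _ f) //.
  rewrite raddf0 => /eqP; rewrite oppr_eq0 mulf_eq0 (negPf A0) orbF => /eqP.
  by move/(congr1 (@poly_rV _ t)); rewrite rVpolyK raddf0.
rewrite redS mul_row_col; apply/row_matrixP=> i.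
rewrite row0 !rowE mulmxDr !mulmxA !bandE -raddfD /=.
move: (delta_mx _ _) => v.
have sB : (size (rVpoly v * B)%R <= dh)%N by apply: (size_cofactor _ _ h).
have sA : (size (rVpoly v * A)%R <= df)%N by apply: (size_cofactor _ _ f).
rewrite mulrN !raddfN /= !poly_rV_K // defA defB mulNr.
by rewrite mulrACA subrr raddf0.
Qed.

Lemma map_resultant_inj (aR rR : nzRingType) (phi : {rmorphism aR -> rR})
    (f h : {poly aR}) : injective phi ->
  phi (resultant f h) = resultant (map_poly phi f) (map_poly phi h).
Proof.
move=> phi_inj; rewrite /resultant /Sylvester_mx.
rewrite !(size_map_inj_poly phi_inj (rmorph0 phi)) -det_map_mx map_col_mx.
by congr (\det (col_mx _ _)); apply: map_lin1_mx => v;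
  rewrite map_poly_rV rmorphM /= map_rVpoly.
Qed.


(** * Coprime factors and derivatives *)

Lemma dvdp_prod_coprime (F : fieldType) (I : finType) (Q : I -> {poly F})
    (w : {poly F}) :
    (forall i j, i != j -> coprimep (Q i) (Q j)) ->
  (forall i, Q i %| w) -> \prod_i Q i %| w.
Proof.
move=> Q_coprime Q_dvd; rewrite -big_enum.
elim: (enum I) (enum_uniq I) => [|i s IHs] /=; first by rewrite big_nil dvd1p.
case/andP=> i_notin uniq_s; rewrite big_cons Gauss_dvdp ?Q_dvd ?IHs //.
rewrite big_seq; apply: (big_ind (coprimep (Q i))) => [|u v|j js].
- exact: coprimep1.
- by rewrite coprimepMr => -> ->.
by apply: Q_coprime; apply: contraNneq i_notin => ->.
Qed.

Lemma dvdp_exp_deriv (F : fieldType) (G w : {poly F}) n :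
  G ^+ n %| w -> G ^+ n.-1 %| w^`().
Proof.
case: n => [_|n]; first by rewrite dvd1p.
case/dvdpP=> u ->; rewrite derivM deriv_exp /= exprS.
apply: dvdp_add; first by rewrite mulrA dvdp_mull.
by rewrite -mulrnAl mulrA dvdp_mulIr.
Qed.


(** * Primes above p and irreducible polynomials over F_p *)

Section ReductionModP.
Variables (p : nat) (p_pr : prime p).

Lemma poly_mod_lift (u : {poly 'F_p}) : exists h, poly_mod p h = u.
Proof.
exists (map_poly (fun x : 'F_p => (x : nat)%:Z) u).
apply/polyP=> j; rewrite coef_map /= coef_map_id0 //=.
by rewrite -pmulrn natr_Zp.
Qed.

Lemma poly_mod_eq0 (h : {poly int}) :
  poly_mod p h = 0 -> exists h', h = h' * p%:R.
Proof.
move=> h0; exists (map_poly (fun a : int => (a %/ p)%Z) h).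
apply/polyP=> j; rewrite -polyC_natr coefMC coef_map_id0 ?div0z //.
rewrite natz divzK // (dvdz_pcharf (pchar_Fp p_pr)).
by move/polyP/(_ j): h0; rewrite coef_map coef0 => /eqP.
Qed.

End ReductionModP.

Lemma ideal_mul_sub (R : comNzRingType) (I J T : set R) :
  ideal T -> (forall u v, I u -> J v -> T (u * v)) ->
  forall x, ideal_mul I J x -> T x.
Proof.
move=> [T0 Tlin] TM x [n [u [v [Iu Jv ->]]]].
elim/big_rec: _ => // j y _ Ty; rewrite -[_ * _]mul1r.
by apply: Tlin => //; apply: TM.
Qed.

Section PrimesAboveP.
Variables (R : comNzRingType) (p : nat) (p_pr : prime p) (c : R).

Definition int_eval (h : {poly int}) : R := (map_poly intr h).[c].

Lemma int_evalD h l : int_eval (h + l) = int_eval h + int_eval l.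
Proof. by rewrite /int_eval rmorphD hornerD. Qed.
Lemma int_evalN h : int_eval (- h) = - int_eval h.
Proof. by rewrite /int_eval rmorphN hornerN. Qed.
Lemma int_evalM h l : int_eval (h * l) = int_eval h * int_eval l.
Proof. by rewrite /int_eval rmorphM hornerM. Qed.
Lemma int_evalX h n : int_eval (h ^+ n) = int_eval h ^+ n.
Proof. by rewrite /int_eval rmorphXn horner_exp. Qed.
Lemma int_eval_nat n : int_eval n%:R = n%:R.
Proof. by rewrite /int_eval rmorph_nat hornerMn hornerC. Qed.
Definition int_evalE :=
  (int_evalD, int_evalN, int_evalM, int_evalX, int_eval_nat).

Lemma int_eval_eq_mod h l : poly_mod p h = poly_mod p l ->
  exists y, int_eval h = int_eval l + p%:R * y.
Proof.
move=> hl; have : poly_mod p (h - l) = 0 by rewrite rmorphB /= hl subrr.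
case/(poly_mod_eq0 p_pr)=> y /(canRL (subrK l)) ->.
by exists (int_eval y); rewrite !int_evalE addrC mulrC.
Qed.

Section OnePrime.
Variable P : set R.
Hypotheses (P_prime : prime_ideal P) (P_p : P p%:R).

Lemma primeD x y : P x -> P y -> P (x + y).
Proof.
by case: P_prime => [[_ lin]] _ _ Px Py; rewrite -[x]mul1r; apply: lin.
Qed.

Lemma primeMl a x : P x -> P (a * x).
Proof.
by case: P_prime => [[P0 lin]] _ _ Px; rewrite -[_ * _]addr0; apply: lin.
Qed.

Lemma primeMr a x : P x -> P (x * a).
Proof. by rewrite mulrC; apply: primeMl. Qed.

Lemma primeN x : P x -> P (- x).
Proof. by rewrite -mulN1r; apply: primeMl. Qed.

Lemma primeM_or x y : P (x * y) -> P x \/ P y.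
Proof.
by case: P_prime => _ _ prim /mem_set/prim/orP[] /set_mem; [left | right].
Qed.

Lemma prime_eval_eq_mod h l :
  poly_mod p h = poly_mod p l -> P (int_eval h) -> P (int_eval l).
Proof.
case/esym/int_eval_eq_mod=> y -> Ph; apply: primeD => //; exact: primeMr.
Qed.

(** The polynomials h modulo p with h(c) in P form an ideal of F_p[X], which is
    principal; a generator is irreducible because P is prime.  The polynomial g
    serves to make this ideal nonzero. *)
Lemma prime_residue_poly (g : {poly int}) :
    poly_mod p g != 0 -> P (int_eval g) ->
  exists G : {poly 'F_p}, irreducible_poly G /\
    forall h, P (int_eval h) <-> G %| poly_mod p h.
Proof.
move=> g0 Pg.
(* Q is this ideal of F_p[X]. *)
pose Q (u : {poly 'F_p}) := exists2 h, poly_mod p h = u & P (int_eval h).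
have Q_mod h : Q (poly_mod p h) <-> P (int_eval h).
  split=> [[l lh Pl]|Ph]; last by exists h.
  exact: prime_eval_eq_mod lh Pl.
have ex_size : exists n, `[< exists u, [/\ Q u, u != 0 & size u = n] >].
  exists (size (poly_mod p g)); apply/asboolP; exists (poly_mod p g).
  by split=> //; apply/Q_mod.
have [n /asboolP[G [QG G0 sG]] min_n] := ex_minnP ex_size.
have G_dvd h : P (int_eval h) <-> G %| poly_mod p h.
  have [Gl GlE PGl] := QG; split=> [Ph|/dvdpP[w hE]].
    apply: contraT => ndvd.
    have [w wE] := poly_mod_lift (poly_mod p h %/ G).
    have /min_n : `[< exists u, [/\ Q u, u != 0
                                  & size u = size (poly_mod p h %% G)] >].
      apply/asboolP; exists (poly_mod p h %% G); split=> //.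
      exists (h - w * Gl); last first.
        by rewrite !int_evalE; apply/primeD/primeN/primeMl.
      rewrite rmorphB rmorphM /= wE GlE {1}(divp_eq (poly_mod p h) G).
      by rewrite addrC addKr.
    by rewrite -sG leqNgt ltn_modp G0.
  have [wl wlE] := poly_mod_lift w.
  apply: (@prime_eval_eq_mod (wl * Gl)); first by rewrite rmorphM /= wlE GlE hE.
  by rewrite int_evalM; apply: primeMl.
exists G; split=> //; split=> [|u su1 uG].
  rewrite ltnNge; apply/negP => /size1_polyC; move: G`_0 => a Gc.
  have : G %| poly_mod p 1.
    rewrite rmorph1 Gc dvdp1 size_polyC.
    by rewrite Gc polyC_eq0 in G0; rewrite G0.
  move/G_dvd; rewrite -[1]/(1%:R) int_eval_nat.
  by case: P_prime.
case/dvdpP: (uG) => w GE.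
have [[wl wlE] [ul ulE]] := (poly_mod_lift w, poly_mod_lift u).
have /G_dvd : G %| poly_mod p (wl * ul) by rewrite rmorphM /= wlE ulE GE.
rewrite int_evalM => /primeM_or[] /G_dvd; rewrite ?wlE ?ulE; last first.
  by move=> Gu; rewrite /eqp uG.
have [w0 u0] : w != 0 /\ u != 0 by apply/andP; rewrite -negb_or -mulf_eq0 -GE.
move/(dvdp_leq w0); rewrite GE size_mul // => sw; exfalso; move: su1 w0 u0 sw.
have arith (a b : nat) :
  (b != 1 -> 0 < a -> 0 < b -> (a + b).-1 <= a -> False)%N by lia.
by rewrite -!size_poly_gt0; apply: arith.
Qed.

Section Residue.
Variable G : {poly 'F_p}.
Hypotheses (G_irr : irreducible_poly G)
  (P_dvd : forall h, P (int_eval h) <-> G %| poly_mod p h).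
Hypothesis gen_mod : forall x, exists h y, x = int_eval h + p%:R * y.

(** Let t = G(c), so that P = (t, p).  Expanding products, for e > 1 every
    element of P ^ e has the form t ^ e a + p b with b in P.  If P ^ e divides
    (p), this applies to p itself: p (1 - b) = t ^ e a.  Suppose that G divides
    g modulo p with exact multiplicity a' < e, with cofactor w.  Then
    w(c) t ^ a' lies in p R, since g(c) = 0, and multiplying by w(c) and
    cancelling p gives (1 - b) w(c) in t R, hence in P.  This is impossible,
    since neither 1 - b nor w(c) lies in P. *)
Lemma ramification_dvd (g : {poly int}) (e : nat) :
    GRing.lreg (p%:R : R) -> int_eval g = 0 ->
  ideal_dvd (ideal_exp P e) (principal p%:R) -> G ^+ e %| poly_mod p g.
Proof.
move=> p_reg g0 [L [_ p_mul]].
have [[P0 _] P1 _] := P_prime.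
have [l lE] := poly_mod_lift G; pose t := int_eval l.
have Pt : P t by apply/P_dvd; rewrite lE.
have P_gen x : P x -> exists a b, x = t * a + p%:R * b.
  have [h [y ->]] := gen_mod x => Pxy.
  have /P_dvd/dvdpP[w hE] : P (int_eval h).
    rewrite -(addrK (p%:R * y) (int_eval h)).
    by apply/primeD/primeN/primeMr.
  have [wl wlE] := poly_mod_lift w.
  have [z ->] : exists z, int_eval h = int_eval (wl * l) + p%:R * z.
    by apply: int_eval_eq_mod; rewrite rmorphM /= wlE lE.
  exists (int_eval wl), (z + y).
  by rewrite int_evalM mulrDr addrA [t * _]mulrC.
(* For n = 1 the condition on b is dropped: p = t 0 + p 1 lies in P. *)
pose T n x := exists a b, x = t ^+ n * a + p%:R * b /\ ((1 < n)%N -> P b).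
have T_ideal n : ideal (T n).
  split=> [|u _ _ [a [b [-> Pb]]] [a' [b' [-> Pb']]]].
    by exists 0, 0; rewrite !mulr0 addr0.
  exists (u * a + a'), (u * b + b'); split; first by ring.
  by move=> n1; apply: primeD; [apply/primeMl/Pb | apply: Pb'].
have exp_T n x : ideal_exp P n x -> T n x.
  elim: n x => [|n IHn] x.
    by move=> _; exists x, 0; rewrite mulr0 addr0 mul1r.
  apply: ideal_mul_sub => // u v /P_gen[a [b ->]] /IHn[a' [b' [-> _]]].
  case: n {IHn} => [|n].
    exists (a * (a' + p%:R * b')), (b * (a' + p%:R * b')).
    by split=> //; ring.
  exists (a * a'), (b * (t ^+ n.+1 * a' + p%:R * b') + t * a * b').
  split=> [|_]; first by rewrite !exprS; ring.
  apply: primeD; last by rewrite -mulrA; apply: primeMr.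
  by apply: primeMl; apply: primeD; rewrite ?exprS -?mulrA; apply: primeMr.
have T_p : T e p%:R.
  have : principal (p%:R : R) p%:R by exists 1; rewrite mulr1.
  rewrite p_mul; apply: ideal_mul_sub => // u v /exp_T[a [b [-> Pb]]] _.
  exists (a * v), (b * v); split=> [|/Pb]; [by ring | exact: primeMr].
apply: contraT => ndvd.
(* The least n with G ^ n not dividing g mod p; it is at least 2. *)
have ex_n : exists n, ~~ (G ^+ n %| poly_mod p g) by exists e.
have [n ndvd_n min_n] := ex_minnP ex_n.
have Gg : G %| poly_mod p g by apply/P_dvd; rewrite g0.
case: n ndvd_n min_n => [|[|n]]; rewrite ?dvd1p ?expr1 ?Gg // => ndvd_n min_n.
have n_lt_e := min_n _ ndvd.
have /dvdpP[w gE] : G ^+ n.+1 %| poly_mod p g.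
  by apply/negPn/negP => /min_n; rewrite ltnn.
have [wl wlE] := poly_mod_lift w.
have [y] : exists y, int_eval (wl * l ^+ n.+1) = int_eval g + p%:R * y.
  by apply: int_eval_eq_mod; rewrite rmorphM rmorphXn /= wlE lE gE.
rewrite g0 add0r !int_evalE -/t => wt.
have [a [b [pE /(_ (leq_trans _ n_lt_e))]]] := T_p.
move=> /(_ isT) Pb.
have eE : e = (n.+1 + (e - n.+2).+1)%N by lia.
have pb : p%:R * (1 - b) = t ^+ e * a by rewrite mulrBr mulr1 {1}pE addrK.
have /p_reg : p%:R * ((1 - b) * int_eval wl)
    = p%:R * (t * (t ^+ (e - n.+2) * a * y)).
  rewrite mulrA pb {1}eE exprD (exprS _ (e - _)).
  transitivity (t * t ^+ (e - n.+2) * a * (int_eval wl * t ^+ n.+1)).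
    by ring.
  by rewrite wt; ring.
move=> eq_t; have : P ((1 - b) * int_eval wl) by rewrite eq_t; apply: primeMr.
case/primeM_or=> [Pb1|].
  by case: P1; rewrite -(subrK b 1); apply: primeD.
move/P_dvd; rewrite wlE => /dvdpP[w' w'E].
by rewrite gE w'E -mulrA -exprS dvdp_mulIr in ndvd_n.
Qed.

(** Elements of R that are independent modulo P have representatives h(c), and
    the remainders of the h by G are then independent in the space of
    polynomials of degree less than that of G. *)
Lemma residue_degree_le (f : nat) :
  has_residue_degree p P f -> (f <= (size G).-1)%N.
Proof.
move=> [b [_ b_free]].
have G0 := irredp_neq0 G_irr.
have /fin_all_exists[h hE] l : exists h, P (int_eval h - b l).
  have [h [y ->]] := gen_mod (b l); exists h.
  by rewrite opprD addNKr; apply/primeN/primeMr.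
pose B : 'M['F_p]_(f, (size G).-1) :=
  \matrix_l poly_rV (poly_mod p (h l) %% G).
rewrite -[X in (X <= _)%N](_ : \rank B = f) ?rank_leq_col //.
apply/eqP; rewrite -/(row_free B); apply: inj_row_free => v vB0.
have G_dvd_sum : G %| poly_mod p (\sum_l h l *+ v 0 l).
  apply/modp_eq0P; transitivity (rVpoly (v *m B)); last by rewrite vB0 raddf0.
  rewrite mulmx_sum_row !raddf_sum /= (big_morph _ (modpD G) (mod0p G)).
  apply: eq_bigr => l _.
  rewrite linearZ /= rowK poly_rV_K; last first.
    by rewrite -ltnS (leq_trans (ltn_modpN0 _ G0)) ?leqSpred.
  by rewrite raddfMn /= -scaler_nat natr_Zp modpZl.
apply/rowP=> l; rewrite mxE.
have /b_free/(_ l) : P (\sum_l b l *~ (v 0 l : nat)).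
  rewrite -(subrKC (int_eval (\sum_l h l *+ v 0 l)) (\sum_l _)).
  apply: primeD; first exact/P_dvd.
  rewrite /int_eval raddf_sum horner_sum -sumrB.
  apply: (big_ind P); [by case: P_prime => [[]] | exact: primeD | move=> m _].
  rewrite raddfMn /= hornerMn -pmulrn -mulrnBl -mulr_natl -opprB.
  by apply: primeMl; apply: primeN; apply: hE.
by rewrite (dvdz_pcharf (pchar_Fp p_pr)) -pmulrn natr_Zp => /eqP.
Qed.

End Residue.
End OnePrime.
End PrimesAboveP.

Section Dedekind.
Variables (R : comNzRingType) (p : nat) (p_pr : prime p) (c : R).
Hypothesis gen_mod : forall x : R, exists h y, x = int_eval c h + p%:R * y.
Hypothesis p_reg : GRing.lreg (p%:R : R).

(** Non-coprime irreducible polynomials are associate, and P is recovered from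
    its polynomial because every element of R is of the form h(c) + p y. *)
Lemma residue_poly_coprime (P P' : set R) (G G' : {poly 'F_p}) :
    prime_ideal P -> prime_ideal P' -> P p%:R -> P' p%:R ->
    irreducible_poly G -> irreducible_poly G' ->
    (forall h, P (int_eval c h) <-> G %| poly_mod p h) ->
    (forall h, P' (int_eval c h) <-> G' %| poly_mod p h) ->
  P <> P' -> coprimep G G'.
Proof.
move=> Pprime P'prime Pp P'p G_irr G'_irr PG PG' neqP.
rewrite irreducible_poly_coprime //; apply/negP => GG'.
have G_eqp : G %= G'.
  by apply: G'_irr => //; case: G_irr => G1 _; rewrite neq_ltn G1 orbT.
have sub (Q Q' : set R) (H H' : {poly 'F_p}) :
    prime_ideal Q -> prime_ideal Q' -> Q p%:R -> Q' p%:R ->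
    (forall h, Q (int_eval c h) <-> H %| poly_mod p h) ->
    (forall h, Q' (int_eval c h) <-> H' %| poly_mod p h) ->
    H' %| H -> forall x, Q x -> Q' x.
  move=> Qpr Q'pr Qp Q'p QH QH' H'H x.
  have [h [y ->]] := gen_mod x => Qhy.
  apply: primeD => //; last exact: primeMr.
  apply/QH'; apply: dvdp_trans H'H _; apply/QH.
  by rewrite -(addrK (p%:R * y) (int_eval c h)); apply: primeD => //;
    apply: primeN => //; apply: primeMr.
apply: neqP; apply/predeqP => x; case/andP: G_eqp => *.
by split; [apply: sub PG PG' _ _ | apply: sub PG' PG _ _].
Qed.

(** The product of the G_j ^ (e_j - 1) is a common divisor of g and g' modulo
    p, of degree at least the sum of the (e_j - 1) f_j. *)
Lemma sum_ramification_le (g : {poly int}) (k r : nat) (q : 'I_r -> set R)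
    (e f : 'I_r -> nat) :
    g \is monic -> int_eval c g = 0 ->
    ~~ (p ^ k.+1 %| `|resultant g g^`()|)%N ->
    injective q -> (forall j, prime_ideal (q j) /\ q j p%:R) ->
    (forall j, has_ramification_index p (q j) (e j)) ->
    (forall j, has_residue_degree p (q j) (f j)) ->
  (\sum_(j < r) (e j - 1) * f j <= k)%N.
Proof.
move=> g_monic g0 hk q_inj q_above he hf.
have gm0 : poly_mod p g != 0 by rewrite monic_neq0 ?monic_map.
have /fin_all_exists[G GP] j : exists G : {poly 'F_p}, irreducible_poly G /\
    forall h, q j (int_eval c h) <-> G %| poly_mod p h.
  have [qpr qp] := q_above j.
  apply: (prime_residue_poly p_pr qpr qp gm0).
  by rewrite g0; case: qpr => [[]].
have G_exp j : G j ^+ e j %| poly_mod p g.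
  have [[qpr qp] [Girr Gdvd] [ej _]] := And3 (q_above j) (GP j) (he j).
  exact: (ramification_dvd p_pr qpr qp Gdvd).
have G_deg j : (f j <= (size (G j)).-1)%N.
  have [[qpr qp] [Girr Gdvd]] := conj (q_above j) (GP j).
  exact: (residue_degree_le p_pr qpr qp Girr Gdvd).
pose w := \prod_j G j ^+ (e j).-1.
have w_coprime i j : i != j -> coprimep (G i ^+ (e i).-1) (G j ^+ (e j).-1).
  move=> ij; apply/coprimep_expl/coprimep_expr.
  have [[qi qip] [Gi iG]] := conj (q_above i) (GP i).
  have [[qj qjp] [Gj jG]] := conj (q_above j) (GP j).
  apply: (residue_poly_coprime qi qj) => // /q_inj/eqP; exact/negP.
have w_g : w %| poly_mod p g.
  apply: dvdp_prod_coprime => // j; apply: dvdp_trans (G_exp j).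
  by rewrite dvdp_exp2l // leq_pred.
have w_dg : w %| poly_mod p g^`().
  apply: dvdp_prod_coprime => // j; rewrite -deriv_map.
  exact: dvdp_exp_deriv.
have size_w : (size w).-1 = (\sum_j (e j).-1 * (size (G j)).-1)%N.
  have G0 j : G j != 0 by case: (GP j) => /irredp_neq0.
  suff [] : w != 0 /\ (size w).-1 = (\sum_j (e j).-1 * (size (G j)).-1)%N.
    by [].
  rewrite /w; elim/big_rec2: _ => [|j s u _ [u0 <-]].
    by rewrite oner_neq0 size_poly1.
  have Gj0 : G j ^+ (e j).-1 != 0 by apply: expf_neq0.
  rewrite mulf_neq0 // size_mul // mulnC -size_exp; split=> //.
  by rewrite (polySpred Gj0) (polySpred u0) addnS.
have := dvdn_resultant_common_divisor p_pr gm0 w_g w_dg.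
rewrite leqNgt; apply: contraL => lt_k.
apply: contra hk; apply: dvdn_trans; rewrite dvdn_exp2l // size_w.
apply: leq_trans lt_k _; apply: leq_sum => j _.
by rewrite subn1 leq_mul.
Qed.

End Dedekind.

(** * Orders of index prime to p *)

(** Lagrange's theorem for the quotient by A: translation by x permutes the
    cosets, so that summing x + r_j over all representatives r_j gives the sum
    of the r_j again, modulo A. *)
Lemma has_index_mulrn (V : zmodType) (A : set V) (i : nat) :
    A 0 -> (forall x y, A x -> A y -> A (x - y)) ->
  has_index A i -> forall x, A (x *+ i).
Proof.
move=> A0 AB [r rP] x.
have AD y z : A y -> A z -> A (y + z).
  move=> Ay Az; rewrite -[z]opprK -[- z]add0r.
  by apply: (AB) => //; apply: (AB).
have /fin_all_exists[s sP] j : exists l, A (x + r j - r l).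
  by case: (rP (x + r j)) => l [Al _]; exists l.
have s_inj : injective s.
  move=> j l sjl; case: (rP (r j)) => m [_ m_uniq].
  rewrite -(m_uniq j) ?subrr // (m_uniq l) //.
  have -> : r j - r l = (x + r j - r (s j)) - (x + r l - r (s l)).
    by rewrite sjl opprB addrA subrK opprD addrACA subrr add0r.
  exact: (AB).
have -> : x *+ i = \sum_j (x + r j - r (s j)).
  rewrite sumrB big_split /= sumr_const card_ord.
  rewrite [X in _ - X](_ : _ = \sum_j r j) ?addrK //.
  by rewrite [RHS](reindex_inj s_inj).
exact: (big_ind A).
Qed.

Lemma bezout_decomposition (R : comNzRingType) (x : R) (i p u v : nat) :
  (u * i = v * p + 1)%N -> x = u%:R * (x *+ i) + p%:R * - (x *+ v).
Proof.
move=> uvE; have uvR : u%:R * i%:R = v%:R * p%:R + 1 :> R.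
  by rewrite -!natrM uvE natrD.
rewrite -!(mulr_natl x).
transitivity (x * (u%:R * i%:R - v%:R * p%:R)); last by ring.
by rewrite uvR; ring.
Qed.

Section RingOfIntegersFacts.
Variables (K : fieldExtType rat).
Local Notation O := (ringOfIntegers K).

Lemma int_val_nat n : int_val (n%:R : O) = n%:R.
Proof. exact: (rmorph_nat (val : O -> K)). Qed.

Lemma int_valM (x y : O) : int_val (x * y) = int_val x * int_val y.
Proof. exact: (rmorphM (val : O -> K)). Qed.

Lemma lreg_nat p : (0 < p)%N -> GRing.lreg (p%:R : O).
Proof.
move=> p0 x y /(congr1 (@int_val K)) pxy; apply: val_inj.
have p_neq0 : (p%:R : K) != 0.
  by rewrite -(rmorph_nat (in_alg K)) fmorph_eq0 pnatr_eq0 -lt0n.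
by apply: (mulfI p_neq0); rewrite -int_val_nat -!int_valM.
Qed.

Lemma int_val_eval (c : O) h :
  int_val (int_eval c h) = (map_poly intr h).[int_val c].
Proof.
rewrite /int_eval -[LHS](horner_map (val : {rmorphism O -> K})) -map_poly_comp.
congr (_.[_]); apply: eq_map_poly => a.
exact: (rmorph_int (val : {rmorphism O -> K})).
Qed.

(** With u i = v p + 1, x = u (i x) - p (v x), and i x lies in Z[c]. *)
Lemma mod_p_monogenic (c : O) (p i : nat) : prime p -> ~~ (p %| i)%N ->
    has_index (monogenic_order (int_val c)) i ->
  forall x : O, exists h y, x = int_eval c h + p%:R * y.
Proof.
move=> p_pr p_ndvd hi x.
have orderE (y : O) :
    monogenic_order (int_val c) y <-> exists h, y = int_eval c h.
  split=> -[h].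
    by move=> yE; exists h; apply: val_inj; rewrite /= int_val_eval.
  by move=> ->; exists h; rewrite int_val_eval.
have order0 : monogenic_order (int_val c) (0 : O).
  by apply/orderE; exists 0; rewrite /int_eval map_poly0 horner0.
have orderB (y z : O) : monogenic_order (int_val c) y ->
    monogenic_order (int_val c) z -> monogenic_order (int_val c) (y - z).
  move=> /orderE[h ->] /orderE[l ->]; apply/orderE; exists (h - l).
  by rewrite !int_evalE.
have /orderE[h hE] := has_index_mulrn order0 orderB hi x.
have i_gt0 : (0 < i)%N by case: (i) p_ndvd; rewrite ?dvdn0.
have /coprimeP[//|[u v] /= uv] : coprime i p.
  by rewrite coprime_sym prime_coprime.
have uvE : (u * i = v * p + 1)%N by lia.
exists (u%:R * h), (- (x *+ v)); rewrite !int_evalE -hE.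
exact: bezout_decomposition.
Qed.

End RingOfIntegersFacts.

(** * Integrality of the roots of G_d(m,n) *)

Section Dynamics.
Variables (d : nat) (d_ge2 : (2 <= d)%N).

Definition int_frac (h : {poly int}) : {fraction {poly rat}} :=
  tofrac (map_poly intr h).

(** Unlike the monic integer polynomials, these ratios are closed under the
    negative exponents in the definition of G_d(m,n). *)
Definition monic_ratio (x : {fraction {poly rat}}) :=
  exists A B : {poly int},
    [/\ A \is monic, B \is monic & x = int_frac A / int_frac B].

Lemma int_fracB A B : int_frac (A - B) = int_frac A - int_frac B.
Proof. by rewrite /int_frac rmorphB tofracB. Qed.

Lemma int_frac_neq0 A : A \is monic -> int_frac A != 0.
Proof. by move=> Am; rewrite tofrac_eq0 monic_neq0 // monic_map. Qed.

Lemma monic_ratio_int A : A \is monic -> monic_ratio (int_frac A).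
Proof.
move=> Am; exists A, 1; split; rewrite ?monic1 //.
by rewrite /int_frac rmorph1 tofrac1 divr1.
Qed.

Lemma monic_ratio1 : monic_ratio 1.
Proof.
suff <- : int_frac 1 = 1 by apply/monic_ratio_int/monic1.
by rewrite /int_frac rmorph1 tofrac1.
Qed.

Lemma monic_ratioM x y : monic_ratio x -> monic_ratio y -> monic_ratio (x * y).
Proof.
move=> [A [B [Am Bm ->]]] [A' [B' [Am' Bm' ->]]].
exists (A * A'), (B * B'); rewrite !monicMl //; split=> //.
by rewrite mulf_div -!tofracM -!rmorphM.
Qed.

Lemma monic_ratioV x : monic_ratio x -> monic_ratio x^-1.
Proof. by move=> [A [B [Am Bm ->]]]; exists B, A; rewrite invf_div. Qed.

Lemma monic_ratioX x n : monic_ratio x -> monic_ratio (x ^+ n).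
Proof.
move=> rx; elim: n => [|n IHn]; first exact: monic_ratio1.
by rewrite exprS; apply: monic_ratioM.
Qed.

Lemma monic_ratioXz x (a : int) : monic_ratio x -> monic_ratio (x ^ a).
Proof.
by case: a => n rx; [|apply: monic_ratioV]; apply: monic_ratioX.
Qed.

Definition crit_orbit (k : nat) : {poly int} := iter k (fun z => z ^+ d + 'X) 0.

Lemma crit_orbitE k :
  iter k (unicritical d (tofrac 'X)) 0 = int_frac (crit_orbit k).
Proof.
elim: k => [|k /= ->]; first by rewrite /int_frac rmorph0 tofrac0.
rewrite /unicritical /int_frac rmorphD rmorphXn /= map_polyX.
by rewrite tofracD tofracXn.
Qed.

(** As d > 1, the power z^d dominates the added c at each step, and the degree
    is multiplied by d. *)
Lemma crit_orbitP k :
  crit_orbit k.+1 \is monic /\ size (crit_orbit k.+1) = (d ^ k).+1.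
Proof.
elim: k => [|k [IHm IHs]].
  rewrite /crit_orbit /= expr0n /=.
  by rewrite -(subnKC d_ge2) add0r monicX size_polyX.
have sD : size (crit_orbit k.+1 ^+ d) = (d ^ k.+1).+1.
  have m_d : crit_orbit k.+1 ^+ d \is monic by apply: monic_exp.
  by rewrite polySpred ?monic_neq0 // size_exp IHs expnSr.
have sX : (size ('X : {poly int}) < size (crit_orbit k.+1 ^+ d))%N.
  rewrite size_polyX sD ltnS (leq_trans d_ge2) //.
  by rewrite -{1}(expn1 d) leq_pexp2l; lia.
split.
  by rewrite monicE /= lead_coefDl // -monicE; apply: monic_exp.
by rewrite /= size_polyDl.
Qed.

(** The degrees along the critical orbit increase strictly, as d > 1, so the
    later term dominates. *)
Lemma crit_orbitB_monic j k : (0 < k)%N ->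
  crit_orbit (k + j) - crit_orbit j \is monic.
Proof.
case: k => // k _; have [m1 s1] := crit_orbitP (k + j).
rewrite monicE lead_coefDl // size_polyN s1.
case: j {m1 s1} => [|j]; first by rewrite size_poly0.
have [_ ->] := crit_orbitP j.
by rewrite ltnS ltn_exp2l //; lia.
Qed.

(** At a point f^j(0), each factor of the dynatomic product is an integral
    power of the difference of two terms of the critical orbit. *)
Lemma monic_ratio_dynatomic n j :
  monic_ratio (dynatomic d (tofrac 'X) n
                 (iter j (unicritical d (tofrac 'X)) 0)).
Proof.
rewrite /dynatomic big_seq.
apply: (big_ind monic_ratio) => [||k kn].
- exact: monic_ratio1.
- exact: monic_ratioM.
apply: monic_ratioXz; rewrite -iterD !crit_orbitE -int_fracB.
apply: monic_ratio_int; apply: crit_orbitB_monic.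
have [n0|n_gt0] := posnP n; first by move: kn; rewrite n0 inE => /eqP->.
by move: kn; rewrite -dvdn_divisors //; apply: dvdn_gt0.
Qed.

Lemma monic_ratio_Gdmn m n : monic_ratio (Gdmn d m n).
Proof.
have dyn0 := monic_ratio_dynatomic n 0.
have gen : monic_ratio (gen_dynatomic d (tofrac 'X) m n 0).
  case: m => [|m] //; apply: monic_ratioM.
    exact: (monic_ratio_dynatomic n m.+1).
  exact/monic_ratioV/monic_ratio_dynatomic.
rewrite /Gdmn; case: ifP => _ //; apply: monic_ratioM => //.
exact/monic_ratioV/monic_ratioX.
Qed.

End Dynamics.

(** Gauss's lemma makes g a rational multiple of an integer factor h of A, and
    the leading coefficient of h is 1 or -1. *)
Lemma monic_dvd_rat_int (g : {poly rat}) (A : {poly int}) :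
    g \is monic -> A \is monic -> g %| map_poly intr A ->
  exists2 h : {poly int}, h \is monic & g = map_poly intr h.
Proof.
move=> g_monic A_monic /dvdpP_rat_int[h [a a0 gE] [r AE]].
have lead1 : lead_coef h * lead_coef r = 1.
  by rewrite -lead_coefM -AE (monicP A_monic).
have lead_sq : lead_coef h * lead_coef h = 1.
  have := congr1 absz lead1; rewrite abszM => /eqP; rewrite muln_eq1.
  by case/andP; case: (lead_coef h) => [[|[|]]|[|]].
(* As lead_coef h is its own inverse, this is the monic associate of h. *)
exists (lead_coef h *: h); first by rewrite monicE lead_coefZ lead_sq eqxx.
have aE : a * (lead_coef h)%:~R = 1.
  have := monicP g_monic; rewrite gE lead_coefZ lead_coef_map_inj //.
  exact: intr_inj.
rewrite map_polyZ /= gE; congr (_ *: _).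
have : (lead_coef h * lead_coef h)%:~R = 1 :> rat by rewrite lead_sq.
by rewrite intrM => /(congr1 ( *%R a)); rewrite mulrA aE mul1r mulr1.
Qed.

Lemma factor_Gdmn_int (d m n : nat) (g : {poly rat}) : (2 <= d)%N ->
  g \is monic -> polynomial_factor g (Gdmn d m n) ->
  exists2 h : {poly int}, h \is monic & g = map_poly intr h.
Proof.
move=> d_ge2 g_monic [h GE].
have [A [B [Am Bm]]] := monic_ratio_Gdmn d_ge2 m n.
rewrite GE => /(canLR (divfK (int_frac_neq0 Bm))).
rewrite -tofracM => /eqP; rewrite tofrac_eq => /eqP gA.
apply: (monic_dvd_rat_int g_monic Am).
by rewrite -gA -mulrA dvdp_mulIl.
Qed.

(** * Ramification and the discriminant of a factor of G_d(m,n) *)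

Unset Implicit Arguments.

Theorem proposition4p2 (d m n : nat) (hd : (2 <= d)%N) (hn : (1 <= n)%N)
  (g : {poly rat}) (g_monic : g \is monic) (g_irr : irreducible_poly g)
  (g_factor : polynomial_factor g (Gdmn d m n))
  (K : fieldExtType rat) (c0 : K)
  (c0_root : root (map_poly (in_alg K) g) c0)
  (c0_gen : <<1; c0>>%VS = {:K}%VS)
  (p : nat) (p_prime : prime p)
  (k : nat)
  (hk : (p ^ k %| `|numq (discriminant g)|)%N)
  (hk_max : ~~ (p ^ k.+1 %| `|numq (discriminant g)|)%N)
  (i : nat) (hi : has_index (monogenic_order c0) i)
  (p_ndvd_i : ~~ (p %| i)%N)
  (r : nat) (q : 'I_r -> set (ringOfIntegers K)) (q_inj : injective q)
  (q_above : forall P : set (ringOfIntegers K),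
     (exists j, q j = P) <-> (prime_ideal P /\ lies_above p P))
  (e f : 'I_r -> nat)
  (he : forall j, has_ramification_index p (q j) (e j))
  (hf : forall j, has_residue_degree p (q j) (f j)) :
  (\sum_(j < r) (e j - 1) * f j <= k)%N.
Proof.
have [gZ gZ_monic gE] := factor_Gdmn_int hd g_monic g_factor.
have c0_root_Z : (map_poly intr gZ).[c0] = 0 :> K.
  move/rootP: c0_root; rewrite gE -map_poly_comp => <-; congr (_.[_]).
  by apply: eq_map_poly => a; apply/esym/(rmorph_int (in_alg K)).
have c0_int : c0 \in algebraic_integer (K := K).
  by apply/asboolP; exists gZ => //; apply/rootP.
pose c : ringOfIntegers K := RingOfIntegers c0_int.
have gen := mod_p_monogenic (c := c) p_prime p_ndvd_i hi.
have p_reg : GRing.lreg (p%:R : ringOfIntegers K).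
  exact/lreg_nat/prime_gt0.
apply: (sum_ramification_le p_prime gen p_reg (g := gZ) gZ_monic) he hf => //.
- by apply: val_inj; rewrite /= int_val_eval.
- apply: contra hk_max; rewrite /discriminant.
  rewrite (monicP g_monic) divr1 gE deriv_map -map_resultant_inj; last first.
    exact: intr_inj.
  by rewrite -(rmorph_sign intr) -intrM numq_int abszM abszX exp1n mul1n.
move=> j; have [qj above] : prime_ideal (q j) /\ lies_above p (q j).
  by apply/q_above; exists j.
by split=> //; apply/(above p); apply: dvdzz.
Qed.
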